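(* Let $K\subseteq\mathbb{R}^d$ be a self-similar set and $s=\dim_H(K)$. Suppose that $\mathcal{H}^s(K)>0$ and that $K$ has a weak $(s,l)$-tangent plane $M$ at some point $a\in K$ (for some integer $l$). Then $K\subseteq M$.
   Context: A self-similar set in $\mathbb{R}^d$ is the attractor of a finite collection $\{S_i\}_{i=1}^m$ of contracting similarities of $\mathbb{R}^d$, i.e. the unique nonempty compact set $K$ with $K=\bigcup_{i=1}^m S_i(K)$ (no separation condition is assumed). $\dim_H$ is Hausdorff dimension, $\mathcal{H}^s$ is $s$-dimensional Hausdorff measure, $B(a,r)$ is the ball of centre $a$ and radius $r$. The $s$-dimensional upper density of $K$ at $a$ is $\Theta^{*s}(K,a)=\limsup_{r\to0}\frac{\mathcal{H}^s(K\cap B(a,r))}{(2r)^s}$. Let $0\le s\le d$. An affine $l$-plane $M\subseteq\mathbb{R}^d$ is called a weak $(s,l)$-tangent plane of $K$ at $a$ if $\Theta^{*s}(K,a)>0$, $a\in M$, and for every $\delta>0$ $$\liminf_{r\to0} r^{-s}\,\mathcal{H}^s\big((K\cap B(a,r))\setminus\{x:\mathrm{dist}(x,M)\le\delta r\}\big)=0.$$ *)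

(* Defs.v *)
(* R^d is the type of row vectors 'rV[R]_d over
   R : realType.  The library's norm on 'rV[R]_d is the sup norm; it is used
   here only for the topology (compactness).  All metric notions below go
   through the Euclidean distance. *)
From HB Require Import structures.
From mathcomp Require Import all_boot all_order all_algebra.
From mathcomp Require Import all_classical all_reals all_analysis.

Set Implicit Arguments.
Unset Strict Implicit.
Unset Printing Implicit Defensive.

Import Order.TTheory GRing.Theory Num.Theory.
Import numFieldNormedType.Exports.

Local Open Scope classical_set_scope.
Local Open Scope ring_scope.

Section Euclidean.
Context {R : realType} {d : nat}.
Implicit Types (x y a : 'rV[R]_d) (A M : set 'rV[R]_d).

Definition euclid_norm x : R := Num.sqrt (\sum_(i < d) x ord0 i ^+ 2).

Definition euclid_dist x y : R := euclid_norm (x - y).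

Definition euclid_ball a (r : R) : set 'rV[R]_d :=
  [set x | euclid_dist x a <= r].

(* Meaningful for nonempty M only; [inf set0 = 0]. *)
Definition dist_to_set x M : R := inf [set euclid_dist x y | y in M].

(* The diameter of the empty set is -oo. *)
Definition euclid_diam A : \bar R :=
  ereal_sup [set (euclid_dist x y)%:E | x in A & y in A].

Definition affine_plane (l : nat) M : Prop :=
  exists (p : 'rV[R]_d) (V : {vspace 'rV[R]_d}),
    \dim V = l /\ M = [set x | x - p \in V].

Definition contracting_similarity (f : 'rV[R]_d -> 'rV[R]_d) : Prop :=
  exists c : R, 0 < c < 1 /\
    forall x y, euclid_dist (f x) (f y) = c * euclid_dist x y.

Definition is_attractor (m : nat) (S : 'I_m -> 'rV[R]_d -> 'rV[R]_d)
    (K : set 'rV[R]_d) : Prop :=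
  [/\ K !=set0, compact K & K = \bigcup_i (S i @` K)].

Definition self_similar (K : set 'rV[R]_d) : Prop :=
  exists (m : nat) (S : 'I_m -> 'rV[R]_d -> 'rV[R]_d),
    (forall i, contracting_similarity (S i)) /\ is_attractor S K.

End Euclidean.

Section Hausdorff.
Context {R : realType} {d : nat}.
Implicit Types (s : R) (A : set 'rV[R]_d).

Local Open Scope ereal_scope.

(* diam(U)^s with the conventions that make H^0 the counting measure:
   the empty set has weight 0, and 0^0 = 1 for nonempty sets. *)
Definition diam_pow s (U : set 'rV[R]_d) : \bar R :=
  if U == set0 then 0 else euclid_diam U `^ s.

Definition hausdorff_premeasure s (delta : R) A : \bar R :=
  ereal_inf [set \sum_(0 <= i <oo) diam_pow s (U i) | U in
    [set U : nat -> set 'rV[R]_d |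
      A `<=` \bigcup_i U i /\ forall i, euclid_diam (U i) <= delta%:E]].

(* Normalized without a volume constant. *)
Definition hausdorff_measure s A : \bar R :=
  ereal_sup [set hausdorff_premeasure s delta A |
    delta in [set delta : R | (0 < delta)%R]].

Definition hausdorff_dim A : \bar R :=
  ereal_inf [set s%:E | s in [set s : R | (0 <= s)%R /\
                                          hausdorff_measure s A = 0]].

(* [0^'+] is the filter of right neighbourhoods of 0, i.e. r -> 0 with r > 0. *)
Definition upper_density s (K : set 'rV[R]_d) (a : 'rV[R]_d) : \bar R :=
  limf_esup (fun r : R => hausdorff_measure s (K `&` euclid_ball a r)
                          * (((2 * r) `^ s)^-1)%R%:E) 0^'+.

Definition weak_tangent_plane s (l : nat)
    (K : set 'rV[R]_d) (a : 'rV[R]_d) (M : set 'rV[R]_d) : Prop :=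
  [/\ affine_plane l M,
      0 < upper_density s K a,
      M a &
      forall delta : R, (0 < delta)%R ->
        limf_einf (fun r : R => (r `^ (- s))%R%:E *
          hausdorff_measure s ((K `&` euclid_ball a r) `\`
             [set x | (dist_to_set x M <= delta * r)%R])) 0^'+ = 0].

End Hausdorff.

(* Main.v *)
(* Around each of its points and at each small scale r, K contains a similar
   copy of itself of ratio comparable to r; hence every ball of radius t centred
   on K carries H^s-measure at least a constant times t^s.  The weak tangent
   condition therefore forces, for every delta and some small r, all points of K
   in B(a, r/2) to lie within O(delta r) of M.  A copy g(K) of ratio comparable
   to r, with a in g(K), sits in this ball.  The directions spanned by
   g(K) - g(a) and by K - a coincide, because g maps K into itself and preserves
   Gram matrices up to scale; rewriting a basis of K - a in terms of its image
   shows that this fixed basis is O(delta)-close to the direction of M.  Letting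
   delta tend to 0, K - a lies in the direction of M. *)
Require Import Defs.
From mathcomp Require Import all_boot all_order all_algebra.
From mathcomp Require Import all_classical all_reals all_analysis.
From mathcomp Require Import ring lra.

Set Implicit Arguments.
Unset Strict Implicit.
Unset Printing Implicit Defensive.

Import Order.TTheory GRing.Theory Num.Theory.
Import numFieldNormedType.Exports.

Local Open Scope classical_set_scope.
Local Open Scope ring_scope.

(** The ratio may be 1 or more: the identity qualifies, and the notion is stable under
    composition. *)
Definition similarity {R : realType} {d : nat} (c : R)
    (f : 'rV[R]_d -> 'rV[R]_d) : Prop :=
  0 < c /\ forall x y, euclid_dist (f x) (f y) = c * euclid_dist x y.

Lemma entry_le_mx_norm {R : realType} m n (A : 'M[R]_(m, n)) i j :
  `|A i j| <= `|A|.
Proof.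
rewrite -[`|A|]/(mx_norm A) mx_normrE.
exact: (le_bigmax _ (fun ij => `|A ij.1 ij.2|) (i, j)).
Qed.

(** * Euclidean norm and its comparison with the sup norm *)

Section EuclideanNorm.
Context {R : realType} {d : nat}.
Implicit Types (x y z v : 'rV[R]_d).

Lemma euclid_norm_ge0 v : 0 <= euclid_norm v.
Proof. exact: sqrtr_ge0. Qed.

Lemma euclid_norm_sqr v : euclid_norm v ^+ 2 = \sum_i v ord0 i ^+ 2.
Proof. by rewrite sqr_sqrtr// sumr_ge0// => i _; exact: sqr_ge0. Qed.

Lemma euclid_norm_sqr_mulmx v : euclid_norm v ^+ 2 = (v *m v^T) ord0 ord0.
Proof.
by rewrite euclid_norm_sqr mxE; apply: eq_bigr => i _; rewrite mxE expr2.
Qed.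

Lemma euclid_norm0_eq0 v : euclid_norm v = 0 -> v = 0.
Proof.
move=> v0; apply/rowP => i; rewrite mxE.
have := euclid_norm_sqr v; rewrite v0 expr0n/= => /esym/eqP.
rewrite psumr_eq0 => [/allP/(_ i)|j _]; last exact: sqr_ge0.
by rewrite mem_index_enum sqrf_eq0 => /(_ isT)/eqP.
Qed.

Lemma coord_le_euclid_norm v i : `|v ord0 i| <= euclid_norm v.
Proof.
rewrite -sqrtr_sqr ler_wsqrtr// (bigD1 i)//= lerDl.
by rewrite sumr_ge0// => j _; exact: sqr_ge0.
Qed.

Lemma euclid_norm_le_mx_norm v : euclid_norm v <= d%:R * `|v|.
Proof.
rewrite -(@ler_pXn2r _ 2) ?nnegrE ?mulr_ge0 ?euclid_norm_ge0//.
rewrite euclid_norm_sqr (@le_trans _ _ (\sum_(i < d) `|v| ^+ 2))//.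
  apply: ler_sum => i _; rewrite -real_normK ?num_real//.
  by rewrite ler_pXn2r ?nnegrE//; exact: entry_le_mx_norm.
rewrite sumr_const card_ord exprMn -[leLHS]mulr_natl ler_wpM2r ?sqr_ge0//.
by rewrite -natrX ler_nat -mulnn; case: (d) => [|n]//; rewrite leq_pmulr.
Qed.

Lemma euclid_dist_ge0 x y : 0 <= euclid_dist x y.
Proof. exact: euclid_norm_ge0. Qed.

Lemma euclid_distxx x : euclid_dist x x = 0.
Proof.
rewrite /euclid_dist subrr; apply/eqP; rewrite -sqrf_eq0 euclid_norm_sqr.
by rewrite big1// => i _; rewrite mxE expr0n.
Qed.

Lemma euclid_distC x y : euclid_dist x y = euclid_dist y x.
Proof.
rewrite /euclid_dist /euclid_norm; congr Num.sqrt.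
by apply: eq_bigr => i _; rewrite !mxE -sqrrN opprB.
Qed.

(** No triangle inequality is required: [|u + v|^2 <= 2 (|u|^2 + |v|^2)], applied with both norms at
    most [r / 2], gives exactly [r^2]. *)
Lemma euclid_ball_half x y (r : R) :
  0 <= r -> euclid_dist x y <= r / 2 ->
  euclid_ball x (r / 2) `<=` euclid_ball y r.
Proof.
move=> r0 xy z; rewrite /euclid_ball/= => zx.
rewrite -(@ler_pXn2r _ 2) ?nnegrE ?euclid_dist_ge0//.
have le2 u v : euclid_norm (u + v : 'rV[R]_d) ^+ 2 <=
    2 * (euclid_norm u ^+ 2 + euclid_norm v ^+ 2).
  rewrite !euclid_norm_sqr -big_split/= mulr_sumr; apply: ler_sum => i _.
  rewrite !mxE; have := sqr_ge0 (u ord0 i - v ord0 i); nra.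
rewrite /euclid_dist -(subrKA x) (le_trans (le2 _ _))//.
rewrite -!/(euclid_dist _ _).
have := euclid_dist_ge0 z x; have := euclid_dist_ge0 x y; nra.
Qed.

Lemma compact_euclid_bounded (K : set 'rV[R]_d) : compact K ->
  exists D, 0 < D /\ forall x y, K x -> K y -> euclid_dist x y <= D.
Proof.
move=> /compact_bounded[N [_ HN]].
pose B := Num.max N 0 + 1.
have NB : N < B.
  by rewrite (@le_lt_trans _ _ (Num.max N 0))// ?le_max ?lexx// ltrDl.
have B0 : 0 <= B by rewrite addr_ge0// le_max lexx orbT.
have KB x : K x -> `|x| <= B by exact: HN.
(* The last [+ 1] keeps the bound positive when [d = 0]. *)
exists (d%:R * (B + B) + 1); split.
  by rewrite ltr_wpDl// mulr_ge0// addr_ge0.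
move=> x y Kx Ky; rewrite (le_trans (euclid_norm_le_mx_norm _))//.
rewrite ler_wpDr// ler_wpM2l// (le_trans (ler_normB _ _))//.
by rewrite lerD// KB.
Qed.

Lemma mulmx_le_euclid_norm (U : 'M[R]_d) : exists C, 0 < C /\
  forall v j, `|(v *m U) ord0 j| <= C * euclid_norm v.
Proof.
exists (\sum_i \sum_j `|U i j| + 1); split.
  by rewrite ltr_wpDl//; do 2![apply: sumr_ge0 => ? _].
move=> v j; rewrite mxE (le_trans (ler_norm_sum _ _ _))//.
rewrite mulrDl mul1r ler_wpDr ?euclid_norm_ge0// mulr_suml.
apply: ler_sum => i _; rewrite normrM mulrC.
apply: ler_pM => //; last exact: coord_le_euclid_norm.
by rewrite (bigD1 j)//= lerDl sumr_ge0.
Qed.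

End EuclideanNorm.

(** * Hausdorff measure under similarities *)

Section HausdorffMeasure.
Context {R : realType} {d : nat}.
Implicit Types (A B U : set 'rV[R]_d) (s c : R) (f : 'rV[R]_d -> 'rV[R]_d).
Local Open Scope ereal_scope.

Lemma euclid_diam_ge0 A : A !=set0 -> 0 <= euclid_diam A.
Proof.
move=> [x Ax]; have <- : (euclid_dist x x)%:E = 0 by rewrite euclid_distxx.
apply: ereal_sup_ubound.
by exists x => //; exists x.
Qed.

Lemma diam_pow_ge0 s A : 0 <= diam_pow s A.
Proof. by rewrite /diam_pow; case: ifP => // _; exact: poweR_ge0. Qed.

Lemma hausdorff_measure_ge0 s A : 0 <= hausdorff_measure s A.
Proof.
apply: (@le_trans _ _ (hausdorff_premeasure s 1 A)).
  apply: le_ereal_inf_tmp => _ [U _ <-].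
  by apply: nneseries_ge0 => n _ _; exact: diam_pow_ge0.
by apply: ereal_sup_ubound; exists 1%R => //=.
Qed.

Lemma le_hausdorff_measure s A B :
  A `<=` B -> hausdorff_measure s A <= hausdorff_measure s B.
Proof.
move=> AB; apply: ge_ereal_sup => _ [e e0 <-].
apply: (@le_trans _ _ (hausdorff_premeasure s e B)); last first.
  by apply: ereal_sup_ubound; exists e.
apply: le_ereal_inf_tmp => _ [U [BU Ue] <-]; apply: ereal_inf_lbound.
by exists U => //; split => //; exact: subset_trans BU.
Qed.

Lemma euclid_diam_preimage c f U : similarity c f ->
  c%:E * euclid_diam (f @^-1` U) <= euclid_diam U.
Proof.
move=> [c0 fc]; rewrite -lee_pdivlMl//; apply: ge_ereal_sup.
move=> _ [x Ux [y Uy <-]]; rewrite lee_pdivlMl// -EFinM -fc.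
by apply: ereal_sup_ubound; exists (f x) => //; exists (f y).
Qed.

Lemma diam_pow_preimage s c f U : (0 <= s)%R -> similarity c f ->
  (c `^ s)%:E * diam_pow s (f @^-1` U) <= diam_pow s U.
Proof.
move=> s0 cf; have [c0 _] := cf; rewrite {1}/diam_pow.
case: ifPn => [_|/set0P[x Ux]]; first by rewrite mule0 diam_pow_ge0.
have Un0 : U !=set0 by exists (f x).
have fU0 : f @^-1` U !=set0 by exists x.
rewrite /diam_pow ifF; last by apply/negbTE/set0P.
rewrite -poweR_EFin -poweRM ?euclid_diam_ge0 ?lee_fin ?(ltW c0)//.
apply: gt0_ler_poweR => //; rewrite ?in_itv/= ?leey ?andbT.
- by rewrite mule_ge0 ?euclid_diam_ge0 ?lee_fin ?(ltW c0).
- exact: euclid_diam_ge0.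
- exact: euclid_diam_preimage.
Qed.

(** Covers of [f @] A[at scale]c *
    e[pull back under]f[to covers of]A[at scale]e[, and each weight shrinks by at least]c [^ s]. *)
Lemma hausdorff_measure_image s c f A : (0 <= s)%R -> similarity c f ->
  (c `^ s)%:E * hausdorff_measure s A <= hausdorff_measure s (f @` A).
Proof.
move=> s0 cf; have [c0 fc] := cf.
rewrite -lee_pdivlMl ?powR_gt0//; apply: ge_ereal_sup => _ [e e0 <-].
rewrite lee_pdivlMl ?powR_gt0//.
apply: (@le_trans _ _ (hausdorff_premeasure s (c * e) (f @` A))); last first.
  by apply: ereal_sup_ubound; exists (c * e)%R => //=; rewrite mulr_gt0.
apply: le_ereal_inf_tmp => _ [U [AU Ue] <-].
apply: (@le_trans _ _ (\sum_(0 <= i <oo)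
    ((c `^ s)%:E * diam_pow s (f @^-1` (U i))))); last first.
  apply: lee_nneseries => [i _ _|i _]; last exact: diam_pow_preimage.
  by rewrite mule_ge0 ?diam_pow_ge0// lee_fin powR_ge0.
rewrite nneseriesZl; last by move=> i _; exact: diam_pow_ge0.
rewrite lee_pmul2l ?lte_fin ?powR_gt0//; apply: ereal_inf_lbound.
exists (fun i => f @^-1` U i) => //; split.
  by move=> x Ax; have [|i _ Ui] := AU (f x); [exists x|exists i].
move=> i; rewrite -(@lee_pmul2l _ c%:E)// ?lte_fin//.
exact: le_trans (euclid_diam_preimage _ cf) (Ue i).
Qed.

Lemma hausdorff_dim_ge0 A : 0 <= hausdorff_dim A.
Proof. by apply: le_ereal_inf_tmp => _ [s [s0 _] <-]; rewrite lee_fin. Qed.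

End HausdorffMeasure.

(** This is the form in which the measure condition of a weak tangent plane is used: one good radius
    below any given bound. *)
Lemma limf_einf0_ex {R : realType} (F : R -> \bar R) (e : \bar R) (r0 : R) :
  (limf_einf F 0^'+ = 0 -> 0 < e -> 0 < r0%:E ->
  exists r : R, 0 < r%:E < r0%:E /\ F r < e)%E.
Proof.
rewrite /limf_einf /limf_esup => /eqP; rewrite oppe_eq0 => /eqP F0 e0.
rewrite lte_fin => r00.
have : (- e < ereal_sup [set (\- F)%E x | x in [set r : R | 0 < r < r0]%R])%E.
  apply: (@lt_le_trans _ _ 0%E); first by rewrite oppe_lt0.
  rewrite -F0; apply: ereal_inf_lbound => /=.
  exists [set r : R | 0 < r < r0] => //.
  near=> t => /=; apply/andP; split; near: t.
    exact: nbhs_right_gt.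
  exact: nbhs_right_lt.
case/ereal_sup_gt => _ [r /= rr <-]; rewrite lteN2 => Fr.
by exists r; rewrite !lte_fin.
Unshelve. all: end_near. Qed.

(** * Small copies, measure of balls, and flatness at good scales *)

Section SmallCopies.
Context {R : realType} {d : nat}.
Implicit Types (K M : set 'rV[R]_d) (a x : 'rV[R]_d) (s c D : R).

Definition has_small_copies c0 K : Prop := forall x r, K x -> 0 < r <= 1 ->
  exists c f, [/\ similarity c f, c0 * r <= c <= r, f @` K `<=` K & (f @` K) x].

(** Follow an address of [x], composing maps until the ratio first drops to [r]; the last map
    overshoots by at most the smallest ratio [c0]. *)
Lemma self_similar_small_copies K : self_similar K ->
  exists c0, 0 < c0 /\ has_small_copies c0 K.
Proof.
move=> [m [S [hS [_ _ KE]]]].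
have [c Hc] := choice hS.
pose q := \big[Num.max/0]_i c i; pose c0 := \big[Num.min/1]_i c i.
have c0_gt0 : 0 < c0 by apply/bigmin_gtP; split => // i _; case/andP: (Hc i).1.
have q1 : q < 1 by apply/bigmax_ltP; split => // i _; case/andP: (Hc i).1.
have c0c i : c0 <= c i by exact: bigmin_le_cond.
have cq i : c i <= q by exact: le_bigmax.
have q0 : 0 <= q by apply: bigmax_ge_id.
exists c0; split => //.
(* Since every ratio is at most [q < 1], a bound [q ^+ n <= r] limits the number of maps composed
   and supports an induction on [n]. *)
suff H n x r : K x -> 0 < r <= 1 -> q ^+ n <= r ->
  exists c f, [/\ similarity c f, c0 * r <= c <= r, f @` K `<=` K & (f @` K) x].
  move=> x r Kx r01; have /andP[r0 _] := r01.
  have /cvgrPdist_lt/(_ _ r0)[N _ HN] : (q ^+ n @[n --> \oo] --> 0).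
    by apply: cvg_expr; rewrite ger0_norm.
  apply: (H N) => //; have := HN N (leqnn N).
  by rewrite /= sub0r normrN ger0_norm ?exprn_ge0// => /ltW.
elim: n x r => [|n IH] x r Kx /andP[r0 r1] qr.
  rewrite expr0 in qr; have -> : r = 1 by apply/le_anti; rewrite r1.
  exists 1, id; rewrite image_id; split => //.
    by split => // y z; rewrite mul1r.
  by rewrite mulr1 lexx andbT bigmin_le_id.
have [i _ [y Ky xE]] : (\bigcup_i (S i @` K)) x by rewrite -KE.
have SK j z : K z -> K (S j z).
  by move=> Kz; rewrite KE; exists j => //; exists z.
have [/andP[ci0 ci1] Sc] := Hc i.
have [cir|rci] := ltP (c i) r.
  exists (c i), (S i); split => //.
  - rewrite (ltW cir) andbT (le_trans _ (c0c i))// ler_piMr// ltW//.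
  - by move=> _ [z Kz <-]; exact: SK.
  - by exists y.
(* Here [S i] is still too large: with [x = S i y], recurse at [y] with the rescaled radius
   [r / c i], which is at most 1. *)
have [||e [g [[e0 ge] /andP[e1 e2] gK [z Kz gz]]]] := IH y (r / c i) Ky.
- by rewrite divr_gt0//= ler_pdivrMr// mul1r.
- rewrite ler_pdivlMr// (le_trans _ qr)// exprSr ler_wpM2l// exprn_ge0//.
exists (c i * e), (S i \o g); split.
- by split; [rewrite mulr_gt0|move=> u v /=; rewrite Sc ge mulrA].
- apply/andP; split; last by rewrite mulrC -ler_pdivlMr.
  by rewrite (mulrC (c i)) -ler_pdivrMr// -mulrA.
- by move=> _ [u Ku <-] /=; apply: SK; apply: gK; exists u.
- by exists z => //=; rewrite gz.
Qed.

(** A copy of [K] through [x] of ratio at most [t / D] has diameter at most [t], so it lies in the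
    ball. *)
Lemma hausdorff_measure_ball_ge s c0 D K x t : 0 <= s -> 0 < c0 -> 0 < D ->
  has_small_copies c0 K ->
  (forall y z, K y -> K z -> euclid_dist y z <= D) ->
  K x -> 0 < t <= D ->
  (((c0 * (t / D)) `^ s)%:E * hausdorff_measure s K <=
   hausdorff_measure s (K `&` euclid_ball x t))%E.
Proof.
move=> s0 c0_gt0 D0 hK KD Kx /andP[t0 tD].
have [|c [f [[c_gt0 fc] /andP[c0c ct] fK [y Ky fy]]]] := hK x (t / D) Kx.
  by rewrite divr_gt0//= ler_pdivrMr// mul1r.
apply: (@le_trans _ _ (hausdorff_measure s (f @` K))).
  apply: le_trans (hausdorff_measure_image _ s0 (conj c_gt0 fc)).
  rewrite lee_wpmul2r ?hausdorff_measure_ge0// lee_fin.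
  apply: ge0_ler_powR => //; rewrite nnegrE; last exact: ltW.
  by rewrite mulr_ge0 ?divr_ge0 ?(ltW t0) ?(ltW D0) ?(ltW c0_gt0).
apply: le_hausdorff_measure => z fKz; split; first exact: fK.
case: fKz => u Ku <-; rewrite /euclid_ball/= -fy fc.
rewrite -[leRHS](divfK (lt0r_neq0 D0)); apply: ler_pM => //; first exact: ltW.
  exact: euclid_dist_ge0.
exact: KD.
Qed.

(** As [U] kills the direction [V], [(z - a) *m U] equals [(z - y) *m U] for every [y] in [M]; take
    the infimum over [y]. *)
Lemma dist_to_affine_ge M p (V : {vspace 'rV[R]_d}) (U : 'M[R]_d) C a z j :
  M = [set x | x - p \in V] -> (forall v, v \in V -> v *m U = 0) ->
  0 < C -> (forall v j, `|(v *m U) ord0 j| <= C * euclid_norm v) ->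
  M a -> `|((z - a) *m U) ord0 j| <= C * dist_to_set z M.
Proof.
move=> ME VU C0 UC Ma; rewrite mulrC -ler_pdivrMr//; apply: lb_le_inf.
  by exists (euclid_dist z a), a.
move=> _ [y My <-]; rewrite ler_pdivrMr// mulrC.
suff -> : (z - a) *m U = (z - y) *m U by exact: UC.
apply/eqP; rewrite -subr_eq0 -mulmxBl VU//.
move: My Ma; rewrite ME/= => My Ma.
have -> : z - a - (z - y) = (y - p) - (a - p).
  by apply/rowP => k; rewrite !mxE; ring.
exact: memvB.
Qed.

(* A point of [K] violating the bound would be the centre of a ball of radius
   [delta r] lying outside the [delta r]-neighbourhood of [M]. *)
Lemma weak_tangent_plane_flat s c0 D K M p (V : {vspace 'rV[R]_d})
    (U : 'M[R]_d) C l a delta r0 :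
  0 <= s -> 0 < c0 -> 0 < D -> has_small_copies c0 K ->
  (forall y z, K y -> K z -> euclid_dist y z <= D) ->
  (0 < hausdorff_measure s K)%E -> weak_tangent_plane s l K a M ->
  M = [set x | x - p \in V] -> (forall v, v \in V -> v *m U = 0) ->
  0 < C -> (forall v j, `|(v *m U) ord0 j| <= C * euclid_norm v) ->
  0 < delta <= 1 / 2 -> 0 < r0 ->
  exists r, 0 < r < r0 /\ forall x j, K x -> euclid_dist x a <= r / 2 ->
    `|((x - a) *m U) ord0 j| <= 2 * C * delta * r.
Proof.
move=> s0 c0_gt0 D0 hK KD HK [_ _ Ma hM] ME VU C0 UC /andP[d0 d1] r00.
pose e := (((c0 * (delta / D)) `^ s)%:E * hausdorff_measure s K)%E.
have e0 : (0 < e)%E.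
  by rewrite mule_gt0// lte_fin powR_gt0// mulr_gt0// divr_gt0.
have [|r []] := limf_einf0_ex (r0 := Num.min r0 D) (hM _ d0) e0.
  by rewrite lte_fin lt_min r00.
rewrite !lte_fin lt_min => /and3P[r_gt0 rr0 rD] Fr.
exists r; split => [|x j Kx xa]; first by rewrite r_gt0.
rewrite leNgt; apply/negP => xj.
have dr0 : 0 < delta * r by rewrite mulr_gt0.
have drr : delta * r <= r / 2 by nra.
move: Fr; rewrite ltNge => /negP; apply.
have -> : e = ((r `^ (- s))%:E *
    (((c0 * (delta * r / D)) `^ s)%:E * hausdorff_measure s K))%E.
  rewrite /e muleA -EFinM; congr (_%:E * _)%E.
  have -> : c0 * (delta * r / D) = r * (c0 * (delta / D)) by ring.
  have q0 : 0 <= c0 * (delta / D) by rewrite ltW// mulr_gt0// divr_gt0.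
  by rewrite (powRM _ (ltW r_gt0) q0) powRN mulKf// gt_eqF// powR_gt0.
rewrite lee_wpmul2l ?lee_fin ?powR_ge0//.
have drD : 0 < delta * r <= D by rewrite dr0; nra.
apply: le_trans (hausdorff_measure_ball_ge s0 c0_gt0 D0 hK KD Kx drD) _.
apply: le_hausdorff_measure => z [Kz zx]; split.
  split=> //; apply: euclid_ball_half (ltW r_gt0) xa _ _.
  exact: le_trans drr.
(* Splitting [x - a] at [z] would give two terms of size at most [C * delta * r], contradicting
   [xj]. *)
move=> /= zM.
have za := dist_to_affine_ge z j ME VU C0 UC Ma.
have xz := UC (x - z) j.
have := ler_normD (((x - z) *m U) ord0 j) (((z - a) *m U) ord0 j).
have <- : ((x - a) *m U) ord0 j =
    ((x - z) *m U) ord0 j + ((z - a) *m U) ord0 j.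
  by rewrite -[x - a](subrKA z) mulmxDl mxE.
rewrite leNgt => /negP; apply.
apply: le_lt_trans xj; move: zx; rewrite /euclid_ball/= euclid_distC.
rewrite -/(euclid_dist x z) in xz => zx.
nra.
Qed.

End SmallCopies.

(** * Gram matrices and the span of a similar copy *)

Section Rigidity.
Context {R : realType} {d : nat}.

Lemma mulmx_entry_le m n p (A : 'M[R]_(m, n)) (B : 'M[R]_(n, p)) (x y : R) i j :
  (forall i j, `|A i j| <= x) -> (forall i j, `|B i j| <= y) ->
  `|(A *m B) i j| <= n%:R * (x * y).
Proof.
move=> Ax By; rewrite mxE (le_trans (ler_norm_sum _ _ _))//.
apply: (@le_trans _ _ (\sum_(k < n) (x * y))).
  by apply: ler_sum => k _; rewrite normrM ler_pM.
by rewrite sumr_const card_ord mulr_natl.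
Qed.

(** The basis consists of differences of points of [K], so that a similarity of [K] into itself can
    be applied to it. Maximality of [n] forces spanning. *)
Lemma maximal_free_differences (K : set 'rV[R]_d) a :
  exists n (X : 'M[R]_(n, d)),
  [/\ row_free X, forall i, K (a + row i X) &
      forall x, K x -> (x - a <= X)%MS].
Proof.
pose P n := `[< exists X : 'M[R]_(n, d), row_free X /\
  forall i, K (a + row i X) >].
have P0 : exists n, P n.
  exists 0%N; apply/asboolP; exists 0; split; last by case.
  by rewrite /row_free mxrank0.
have Pd n : P n -> (n <= d)%N.
  by move=> /asboolP[X [/eqP Xn _]]; rewrite -Xn; exact: rank_leq_col.
case: (ex_maxnP P0 Pd) => n /asboolP[X [Xfree KX]] nmax.
exists n, X; split => // x Kx; apply/negPn/negP => xX.
suff /nmax : P (n + 1)%N by rewrite addn1 ltnn.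
apply/asboolP; exists (col_mx X (x - a)); split.
  rewrite /row_free eqn_leq rank_leq_row -addsmxE.
  suff : (\rank X < \rank (X + (x - a)%R)%MS)%N by rewrite (eqP Xfree) addn1.
  apply: rank_ltmx; rewrite /ltmx addsmxSl/=.
  by apply: contra xX; apply: submx_trans; exact: addsmxSr.
move=> i; case: (split_ordP i) => k ->.
  by rewrite rowKu.
by rewrite rowKd (ord1 k) row_id addrC subrK.
Qed.

(** If [v] kills the Gram matrix then [v *m X] has norm 0. *)
Lemma gram_unitmx n (X : 'M[R]_(n, d)) : row_free X -> X *m X^T \in unitmx.
Proof.
move=> Xfree; rewrite -row_free_unit -kermx_eq0; apply/rowV0P => v.
move=> /sub_kermxP vX; apply/eqP; rewrite -(mulmx_free_eq0 _ Xfree); apply/eqP.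
apply: euclid_norm0_eq0; apply/eqP; rewrite -sqrf_eq0 euclid_norm_sqr_mulmx.
by rewrite trmx_mul !mulmxA -(mulmxA v) vX mul0mx mxE.
Qed.

(** Polarization: Gram entries become distances, which a similarity scales. *)
Lemma mulmx_trE n (Y : 'M[R]_(n, d)) i j : (Y *m Y^T) i j =
  (euclid_norm (row i Y) ^+ 2 + euclid_norm (row j Y) ^+ 2
   - euclid_norm (row i Y - row j Y) ^+ 2) / 2.
Proof.
rewrite !euclid_norm_sqr -big_split/= -sumrB mulr_suml mxE.
by apply: eq_bigr => k _; rewrite !mxE; field.
Qed.

(* [Y] is again a basis of the row space of [X], so [X = T Y]; multiplying by
   [Y^T] and inverting the Gram matrix gives [T]. *)
Lemma similar_gram_factor n (X Y : 'M[R]_(n, d)) c : c != 0 -> row_free X ->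
  (Y <= X)%MS -> Y *m Y^T = c ^+ 2 *: (X *m X^T) ->
  X = c ^- 2 *: (X *m Y^T *m invmx (X *m X^T) *m Y).
Proof.
move=> c0 Xfree YX YYX; have Gu := gram_unitmx Xfree.
have Yfree : row_free Y.
  rewrite -kermx_eq0; apply/rowV0P => v /sub_kermxP vY.
  have : v *m (Y *m Y^T) = 0 by rewrite mulmxA vY mul0mx.
  rewrite YYX -scalemxAr => /eqP; rewrite scaler_eq0 sqrf_eq0 (negbTE c0)/=.
  by move=> /eqP v0; rewrite -(mulmxK Gu v) v0 mul0mx.
have /submxP[T XT] : (X <= Y)%MS.
  by rewrite -(mxrank_leqif_sup YX) (eqP Xfree) (eqP Yfree).
rewrite {2}XT -(mulmxA T) YYX -scalemxAr -!scalemxAl mulmxK//.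
by rewrite scalerA mulVf ?sqrf_eq0// scale1r -XT.
Qed.

End Rigidity.

(** * Combining flatness with rigidity *)

Theorem proposition2p2 (R : realType) (d : nat) (K : set 'rV[R]_d) (s : R)
    (l : nat) (a : 'rV[R]_d) (M : set 'rV[R]_d)
    (hK : self_similar K)
    (hs : hausdorff_dim K = s%:E)
    (hpos : (0 < hausdorff_measure s K)%E)
    (ha : K a)
    (hM : weak_tangent_plane s l K a M) :
  K `<=` M.
Proof.
have s0 : 0 <= s by rewrite -lee_fin -hs; exact: hausdorff_dim_ge0.
have [c0 [c0_gt0 Kcopy]] := self_similar_small_copies hK.
have [D [D0 KD]] : exists D, 0 < D /\
    forall x y, K x -> K y -> euclid_dist x y <= D.
  by case: hK => m [S [_ [_ Kc _]]]; exact: compact_euclid_bounded.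
have [[p [V [_ ME]]] _ Ma _] := hM.
(* The projection complementary to [projv V]; its kernel is exactly [V]. *)
pose U : 'M[R]_d := 1%:M - lin1_mx (projv V).
have UE v : v *m U = v - projv V v by rewrite mulmxBr mulmx1 mul_rV_lin1.
have VU v : v \in V -> v *m U = 0 by move=> vV; rewrite UE projv_id// subrr.
have UV v : v *m U = 0 -> v \in V.
  by rewrite UE => /eqP; rewrite subr_eq0 => /eqP ->; exact: memv_proj.
have [C [C0 UC]] := mulmx_le_euclid_norm U.
have [n [X [Xfree KX Xspan]]] := maximal_free_differences K a.
suff XU : X *m U = 0.
  move=> x Kx; rewrite ME/=.
  have -> : x - p = (x - a) + (a - p) by rewrite subrKA.
  apply: memvD; last by move: Ma; rewrite ME.
  by apply: UV; have /submxP[T ->] := Xspan x Kx; rewrite -mulmxA XU mulmx0.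
pose gam := `|invmx (X *m X^T)|.
(* Product of the entry bounds for the factors of [X *m U] obtained below, free of [delta] and of
   the scale. *)
pose B := n%:R * (n%:R * (d%:R * (D * D) * gam) * (8 * C * D / c0)).
suff small delta i j : 0 < delta <= 1 / 2 -> `|(X *m U) i j| <= B * delta.
  apply/matrixP => i j; rewrite [RHS]mxE; apply/eqP; rewrite -normr_le0.
  apply/ler_addgt0Pl => e e0; rewrite addr0.
  have B0 : 0 <= B.
    by rewrite /B !mulr_ge0 ?invr_ge0 ?normr_ge0 ?(ltW D0) ?(ltW C0)
      ?(ltW c0_gt0).
  pose delta := Num.min (1 / 2) (e / (B + 1)).
  have B1 : 0 < B + 1 by rewrite ltr_wpDl.
  have delta0 : 0 < delta by rewrite lt_min divr_gt0//= divr_gt0.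
  have d12 : delta <= 1 / 2 by rewrite ge_min lexx.
  apply: le_trans (small delta i j _) _; first by rewrite delta0.
  have : delta <= e / (B + 1) by rewrite ge_min lexx orbT.
  by rewrite ler_pdivlMr//; nra.
move=> d01.
have D2 : 0 < 2 * D by rewrite mulr_gt0.
have [r [/andP[r_gt0 rD] flat]] := weak_tangent_plane_flat s0 c0_gt0 D0 Kcopy KD
  hpos hM ME VU C0 UC d01 D2.
(* The scale [r / (2 * D)] makes the copy have diameter at most [r / 2]; as it contains [a],
   flatness applies to all of it. *)
have [|c [g [[c_gt0 gc] /andP[rc cr] gK [y Ky gy]]]] :=
  Kcopy a (r / (2 * D)) ha.
  by rewrite divr_gt0//= ler_pdivrMr// mul1r ltW.
have gflat x k : K x -> `|((g x - a) *m U) ord0 k| <= 2 * C * delta * r.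
  move=> Kx; apply: flat; first by apply: gK; exists x.
  rewrite -gy gc (@le_trans _ _ (r / (2 * D) * D))//.
    by apply: ler_pM => //; [exact: ltW|exact: euclid_dist_ge0|exact: KD].
  by rewrite le_eqVlt; apply/orP; left; apply/eqP; field; rewrite gt_eqF.
(* Differences are taken from [g a], since [g] need not fix [a]. *)
pose Y : 'M[R]_(n, d) := \matrix_i (g (a + row i X) - g a).
have rowY k : row k Y = g (a + row k X) - g a by rewrite rowK.
have YX : (Y <= X)%MS.
  apply/row_subP => k; rewrite rowY.
  have -> : g (a + row k X) - g a = (g (a + row k X) - a) - (g a - a).
    by rewrite opprB subrKA.
  by apply: addmx_sub; rewrite ?eqmx_opp; apply: Xspan; apply: gK;
    [exists (a + row k X)|exists a].
have norm_rowX k : euclid_norm (row k X) = euclid_dist (a + row k X) a.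
  by rewrite /euclid_dist addrC addKr.
have norm_rowY k : euclid_norm (row k Y) = c * euclid_norm (row k X).
  by rewrite rowY norm_rowX -gc.
have YYX : Y *m Y^T = c ^+ 2 *: (X *m X^T).
  apply/matrixP => k k'; rewrite [RHS]mxE !mulmx_trE !norm_rowY !rowY.
  have -> : euclid_norm (g (a + row k X) - g a - (g (a + row k' X) - g a)) =
      c * euclid_norm (row k X - row k' X).
    rewrite opprB subrKA -[LHS]/(euclid_dist _ _) gc; congr (_ * euclid_norm _).
    by rewrite opprD addrACA subrr add0r.
  by field.
have Xbd k k' : `|X k k'| <= D.
  have := coord_le_euclid_norm (row k X) k'; rewrite mxE => /le_trans; apply.
  by rewrite norm_rowX; exact: KD.
have Ybd k k' : `|Y^T k k'| <= c * D.
  have := coord_le_euclid_norm (row k' Y) k; rewrite !mxE => /le_trans; apply.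
  rewrite norm_rowY ler_pM2l// norm_rowX; exact: KD.
have YUbd k k' : `|(Y *m U) k k'| <= 8 * C * D / c0 * delta * c.
  have -> : (Y *m U) k k' = ((g (a + row k X) - a) *m U) ord0 k' -
      ((g a - a) *m U) ord0 k'.
    transitivity (row k (Y *m U) ord0 k'); first by rewrite [RHS]mxE.
    by rewrite row_mul rowY -[g _ - g a](subrKA a) -(opprB (g a)) mulmxBl !mxE.
  apply: le_trans (ler_normB _ _) _.
  apply: le_trans (lerD (gflat _ _ (KX k)) (gflat _ _ ha)) _.
  move: rc; rewrite mulrA ler_pdivrMr// => rc.
  (* The lower bound on the ratio of the copy trades [r] for [c]. *)
  have r_le : r <= c * (2 * D) / c0 by rewrite ler_pdivlMr// mulrC.
  have -> : 8 * C * D / c0 * delta * c = 4 * C * delta * (c * (2 * D) / c0).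
    by ring.
  have -> : 2 * C * delta * r + 2 * C * delta * r = 4 * C * delta * r by ring.
  by rewrite ler_wpM2l// !mulr_ge0 ?ltW//; case/andP: d01.
have c_neq0 : c != 0 by rewrite gt_eqF.
(* The factor [c ^- 2] cancels the two factors [c] bounding [Y^T] and [Y *m U], so the bound
   survives as the copy shrinks. *)
rewrite (similar_gram_factor c_neq0 Xfree YX YYX) -scalemxAl mxE -mulmxA.
have Gbd k k' : `|invmx (X *m X^T) k k'| <= gam by exact: entry_le_mx_norm.
have XYbd k k' := mulmx_entry_le k k' Xbd Ybd.
have XYGbd k k' := mulmx_entry_le k k' XYbd Gbd.
have := mulmx_entry_le i j XYGbd YUbd.
rewrite normrM ger0_norm ?invr_ge0 ?sqr_ge0// => bd.
rewrite ler_pdivrMl ?exprn_gt0//; apply: le_trans bd _.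
by rewrite le_eqVlt; apply/orP; left; apply/eqP; rewrite /B; ring.
Qed.
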